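(* Let $0<\delta<1$ and $w>\sqrt{e}$, and let the number of samples $K\in\mathbb{N}$ satisfy $$K\ \geq\ \max\left\{\frac{\log(\#\mathcal{P})+\log(\delta^{-1})}{\log(w/\sqrt{e})},\ 3\right\}.$$ Then $$\mathbb{P}\Big\{ w^{-1}\Delta(\mu)\leq \|u(\mu)-\widetilde u(\mu)\|_\Sigma\leq w\,\Delta(\mu)\ \text{ for all } \mu\in\mathcal{P}\Big\}\geq 1-\delta,$$ and therefore $$\mathbb{P}\Big\{ w^{-1}\Delta\leq \sqrt{\tfrac{1}{\#\mathcal{P}}\sum_{\mu\in\mathcal{P}}\|u(\mu)-\widetilde u(\mu)\|_\Sigma^2}\leq w\,\Delta\Big\}\geq 1-\delta .$$
   Context: Setting. $\mathcal{P}=\mathcal{P}_1\times\cdots\times\mathcal{P}_p\subset\mathbb{R}^p$ is a nonempty finite parameter set (each $\mathcal{P}_i\subset\mathbb{R}$ finite), with cardinality $\#\mathcal{P}$. For each $\mu=(\mu_1,\dots,\mu_p)\in\mathcal{P}$, $A(\mu)\in\mathbb{R}^{N\times N}$ is an invertible matrix, $f(\mu)\in\mathbb{R}^N$, and $u(\mu)\in\mathbb{R}^N$ is the solution of $A(\mu)u(\mu)=f(\mu)$. An approximation of $u$ is a given deterministic function $\widetilde u:\mathcal{P}\to\mathbb{R}^N$ of the separated form $\widetilde u(\mu)=\sum_{m=1}^M u^m_{\mathcal X}\,u^m_1(\mu_1)\cdots u^m_p(\mu_p)$ with $u^m_{\mathcal X}\in\mathbb{R}^N$ and $u^m_i:\mathcal{P}_i\to\mathbb{R}$.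 The residual is $r(\mu)=f(\mu)-A(\mu)\widetilde u(\mu)$. $\Sigma\in\mathbb{R}^{N\times N}$ is a symmetric positive semi-definite matrix and $\|v\|_\Sigma=\sqrt{v^T\Sigma v}$ is the associated semi-norm. $Z_1,\dots,Z_K$ are independent Gaussian random vectors in $\mathbb{R}^N$ with mean zero and covariance $\Sigma$ (possibly singular). $Y_i(\mu)\in\mathbb{R}^N$ denotes the solution of the random dual problem $A(\mu)^TY_i(\mu)=Z_i$, $1\leq i\leq K$. Error estimators: $$\Delta(\mu)=\sqrt{\frac1K\sum_{i=1}^K\big(Z_i^T(u(\mu)-\widetilde u(\mu))\big)^2}=\sqrt{\frac1K\sum_{i=1}^K\big(Y_i(\mu)^Tr(\mu)\big)^2},\qquad \Delta=\sqrt{\frac{1}{\#\mathcal{P}}\sum_{\mu\in\mathcal{P}}\Delta(\mu)^2}.$$ $\log$ is the natural logarithm and $e=\exp(1)$. *)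

(* Defs.v *)
From HB Require Import structures.
From mathcomp Require Import all_boot all_order all_algebra finmap.
From mathcomp Require Import all_classical all_reals all_analysis.

Set Implicit Arguments.
Unset Strict Implicit.
Unset Printing Implicit Defensive.

Import Order.TTheory GRing.Theory Num.Theory.
Import numFieldNormedType.Exports.

Local Open Scope classical_set_scope.
Local Open Scope ring_scope.

(* Values outside the product set are irrelevant throughout: parameter
   dependent objects are functions on all of R^p, constrained on it only. *)
Definition prodset (R : realType) (p : nat) (Pi : 'I_p -> set R)
    : set 'rV[R]_p :=
  [set mu | forall i, Pi i (mu 0 i)].

(* Only meaningful for finite sets: [fset_set] is empty otherwise. *)
Definition ncard (T : choiceType) (A : set T) : nat := #|` fset_set A|.

Lemma finite_prodset (R : realType) (p : nat) (Pi : 'I_p -> set R) :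
  (forall i, finite_set (Pi i)) -> finite_set (prodset Pi).
Proof.
move=> finPi.
pose s i : seq R := fset_set (Pi i).
have sP i x : Pi i x -> x \in s i by move=> ?; rewrite in_fset_set// inE.
pose g (h : {ffun forall i : 'I_p, seq_sub (s i)}) : 'rV[R]_p :=
  \row_i ssval (h i).
apply: (@sub_finite_set _ _ (g @` [set: {dffun forall i : 'I_p, seq_sub (s i)}])).
  move=> mu Pmu /=.
  exists [ffun i => SeqSub (sP i _ (Pmu i))] => //.
  by apply/rowP => i; rewrite mxE ffunE.
exact/finite_image/finite_finset.
Qed.

Definition separated_form (R : realType) (p N M : nat) (Pi : 'I_p -> set R)
    (v : 'rV[R]_p -> 'cV[R]_N) : Prop :=
  exists (vX : 'I_M -> 'cV[R]_N) (vi : 'I_M -> 'I_p -> R -> R),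
    forall mu, prodset Pi mu ->
      v mu = \sum_(m < M) (\prod_(i < p) vi m i (mu 0 i)) *: vX m.

Definition psdmx (R : realType) (N : nat) (S : 'M[R]_N) : Prop :=
  S^T = S /\ forall v : 'cV[R]_N, 0 <= (v^T *m S *m v) 0 0.

Definition seminorm (R : realType) (N : nat) (S : 'M[R]_N) (v : 'cV[R]_N) : R :=
  Num.sqrt ((v^T *m S *m v) 0 0).

Definition borel (X : topologicalType) : set (set X) := <<s open >>.

(* [normal_prob m 0] is not the point mass at [m] in the library (it is the
   uniform law on [0, 1]), hence the explicit degenerate case. *)
Definition gaussian_law (R : realType) (m s : R) (B : set R) : \bar R :=
  if s == 0 then \d_m B else normal_prob m s B.

Definition gaussian_rv (d : measure_display) (T : measurableType d)
    (R : realType) (P : probability T R) (X : T -> R) : Prop :=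
  exists m s : R, forall B : set R, measurable B ->
    P (X @^-1` B) = gaussian_law m s B.

Section random_vectors.
Context (d : measure_display) (T : measurableType d) (R : realType).
Variables (P : probability T R) (N : nat).

Definition random_vector (Z : T -> 'cV[R]_N) : Prop :=
  forall B, borel B -> measurable (Z @^-1` B).

(* Every linear combination of the entries has a, possibly degenerate,
   univariate normal law; this allows singular covariance matrices. *)
Definition gaussian_vector (Z : T -> 'cV[R]_N) : Prop :=
  random_vector Z /\
  forall a : 'cV[R]_N, gaussian_rv P (fun x => (a^T *m Z x) 0 0).

Definition has_mean (Z : T -> 'cV[R]_N) (m : 'cV[R]_N) : Prop :=
  forall j, 'E_P[fun x => Z x j ord0]%E = (m j 0)%:E.

Definition has_cov (Z : T -> 'cV[R]_N) (S : 'M[R]_N) : Prop :=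
  forall j k, covariance P (fun x => Z x j 0) (fun x => Z x k 0) = (S j k)%:E.

(* Mutual independence; subfamilies are covered by taking [B i = setT]. *)
Definition independent_vectors (K : nat) (Z : 'I_K -> T -> 'cV[R]_N) : Prop :=
  forall B : 'I_K -> set 'cV[R]_N, (forall i, borel (B i)) ->
    P (\bigcap_(i in [set: 'I_K]) (Z i @^-1` B i)) =
    (\prod_(i < K) P (Z i @^-1` B i))%E.

End random_vectors.

Definition residual (R : realType) (N : nat) (A : 'M[R]_N)
    (f v : 'cV[R]_N) : 'cV[R]_N := f - A *m v.

Definition estimator (R : realType) (N K : nat) (V : 'I_K -> 'cV[R]_N)
    (v : 'cV[R]_N) : R :=
  Num.sqrt (K%:R^-1 * \sum_(i < K) (((V i)^T *m v) 0 0) ^+ 2).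

(* The primal expression of the estimator, with the samples [Z i] and the
   error, agrees with its dual expression, with [Y i] and the residual. *)
Lemma estimator_dual (R : realType) (N K : nat) (A : 'M[R]_N)
    (f u v : 'cV[R]_N) (Z Y : 'I_K -> 'cV[R]_N) :
  A *m u = f -> (forall i, A^T *m Y i = Z i) ->
  estimator Z (u - v) = estimator Y (residual A f v).
Proof.
move=> Au AY; rewrite /estimator /residual; congr (Num.sqrt (_ * _)).
apply: eq_bigr => i _.
by rewrite -AY -Au -mulmxBr trmx_mul trmxK mulmxA.
Qed.

Definition rms (R : realType) (T : choiceType) (A : set T) (F : T -> R) : R :=
  Num.sqrt ((ncard A)%:R^-1 * \sum_(t \in A) F t ^+ 2).

(* Main.v *)
(* For a fixed parameter, the products of the samples with the error are
   independent centered Gaussians whose variance [v] is the squared seminorm of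
   the error, so [K * Delta ^+ 2 / v] has the chi-squared law with [K] degrees
   of freedom. The Chernoff bound, with exponents
   [(1 - w ^- 2) / (2 v)] and [(1 - w ^+ 2) / (2 v)], bounds its upper and lower
   tails by [(sqrt e / w) ^+ K] times [(w ^+ 2 * e ^ (- w ^+ 2 / 2)) ^+ K] and
   [e ^ (- K / (2 w ^+ 2))], and these two factors add up to at most 1 when
   [K >= 3]. A union bound over the parameters concludes; the statement on
   averages follows because the root mean square is monotone. *)
Require Import Defs.
From mathcomp Require Import all_boot all_order all_algebra finmap.
From mathcomp Require Import all_classical all_reals all_analysis.
From mathcomp Require Import measurable_realfun ring lra.

Import Order.TTheory GRing.Theory Num.Theory.
Import numFieldNormedType.Exports.

Local Open Scope classical_set_scope.
Local Open Scope ring_scope.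

(** * Numerical bounds on the exponential *)

Lemma expR1_ge (R : realType) : 27 / 10 <= expR 1 :> R.
Proof.
(* The first five terms of the exponential series add up to 65/24, just above 2.7. *)
apply: le_trans (nondecreasing_cvgn_le _ (is_cvg_series_exp_coeff 1) 5).
  rewrite /series/= !big_nat_recr//= big_nil /exp_coeff/= !expr1n.
  have [f2 f3 f4] : [/\ 2`! = 2%N, 3`! = 6%N & 4`! = 24%N] by [].
  by rewrite fact0 (_ : 1`! = 1%N)// f2 f3 f4; lra.
apply: nondecreasing_series => n _ _; exact: exp_coeff_ge0.
Qed.

(** The tangent to the exponential at 1 passes through the origin. *)
Lemma expR1M_le (R : realType) (x : R) : expR 1 * x <= expR x.
Proof.
rewrite [in leRHS](_ : x = 1 + (x - 1)); last by ring.
by rewrite expRD ler_pM2l ?expR_gt0//; have := expR_ge1Dx (x - 1); lra.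
Qed.

Lemma sqrt_expR1 (R : realType) : Num.sqrt (expR 1) = expR 2^-1 :> R.
Proof.
rewrite -[RHS]ger0_norm ?expR_ge0// -sqrtr_sqr -expRM_natl.
by congr (Num.sqrt (expR _)); rewrite mulfV.
Qed.

(* Both terms decrease in [K], and at [K = 3] the sum is at most about 0.92,
   which leaves room for the bounds [y <= expR (y / expR 1)] and
   [1 + x <= expR x]. *)
Lemma chi2_tails_le1 (R : realType) (y : R) (K : nat) :
  expR 1 <= y -> (3 <= K)%N ->
  (y * expR (- (y / 2))) ^+ K + expR (- (2 * y)^-1) ^+ K <= 1.
Proof.
move=> ey K3; have e27 := @expR1_ge R.
have expM := @expR1M_le R.
move: (expR 1) (erefl (@expR R 1)) e27 ey expM => e _ e27 ey expM.
have y0 : 0 < y by lra.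
have e0 : e != 0 by rewrite gt_eqF//; lra.
have yexp : y <= expR (y / e) by have := expM (y / e); rewrite mulrC divfK.
have y1 : y * expR (- (y / 2)) <= 1.
  apply: le_trans (_ : expR (y / e) * expR (- (y / 2)) <= _).
    by rewrite ler_wpM2r ?expR_ge0.
  rewrite -expRD expR_le1 subr_le0 ler_wpM2l//; first lra.
  by rewrite lef_pV2 ?posrE; lra.
have z1 : expR (- (2 * y)^-1) <= 1.
  by rewrite expR_le1 oppr_le0 invr_ge0; lra.
have step (x : R) : 0 <= x -> x <= 1 -> x ^+ K <= x ^+ 3.
  by move=> x0 x1; exact: ler_wiXn2l.
apply: le_trans (lerD (step _ _ y1) (step _ _ z1)) _.
- by rewrite mulr_ge0 ?expR_ge0//; lra.
- exact: expR_ge0.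
(* The two cubes get bounds with the common denominator [2 * y + 3] and the numerators 3 and
   [2 * y], so that they add up to 1. Here [e * z <= expR z] reduces the claim to
   [(2 * y + 3) / 3 <= (3 / 2 * e - 3) * y], which follows from [27 / 10 <= e <= y]. *)
have up : (y * expR (- (y / 2))) ^+ 3 <= 3 / (2 * y + 3).
  apply: le_trans (_ : (expR (y / e) * expR (- (y / 2))) ^+ 3 <= _).
    rewrite lerXn2r ?nnegrE ?mulr_ge0 ?expR_ge0//; first lra.
    by rewrite ler_wpM2r ?expR_ge0.
  rewrite -expRD -expRM_natl.
  have -> : 3%:R * (y / e + - (y / 2)) = - ((3 / 2 - 3 / e) * y) by field.
  rewrite expRN -[leRHS]invf_div lef_pV2 ?posrE ?expR_gt0//; last first.
    by rewrite divr_gt0; lra.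
  apply: le_trans (expM _).
  have -> : e * ((3 / 2 - 3 / e) * y) = (3 / 2 * e - 3) * y by field.
  by rewrite ler_pdivrMr//; nra.
have lo : expR (- (2 * y)^-1) ^+ 3 <= 2 * y / (2 * y + 3).
  rewrite -expRM_natl mulrN expRN -[leRHS]invf_div lef_pV2 ?posrE ?expR_gt0//.
    apply: le_trans (expR_ge1Dx _).
    by rewrite le_eqVlt; apply/orP; left; apply/eqP; field; rewrite gt_eqF.
  by rewrite divr_gt0; lra.
apply: le_trans (lerD up lo) _.
by rewrite -mulrDl addrC divff// gt_eqF//; lra.
Qed.

(** * Integration against a density and Gaussian exponential integrals *)

Section integral_density.
Import HBNNSimple.

(** The hypothesis says that [nu] is the image under [X] of the measure with density [g]. Monotone
    convergence along simple functions increasing to [f] reduces the identity to single level sets,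
    where it is this hypothesis. It serves twice: for the normal density, with [X] the identity, and
    to freeze factors of a product of independent variables. *)
Lemma ge0_integral_density (d d' : measure_display) (T : measurableType d)
    (T' : measurableType d') (R : realType) (mu : {measure set T -> \bar R})
    (nu : {measure set T' -> \bar R}) (X : T -> T') (g : T -> R) :
  measurable_fun setT X -> measurable_fun setT g -> (forall x, 0 <= g x) ->
  (forall B, measurable B -> (nu B = \int[mu]_(x in X @^-1` B) (g x)%:E)%E) ->
  forall f : T' -> \bar R, measurable_fun setT f -> (forall y, (0 <= f y)%E) ->
  (\int[nu]_y f y = \int[mu]_x (f (X x) * (g x)%:E))%E.
Proof.
move=> mX mg g0 nuE f mf f0.
pose h := nnsfun_approx measurableT mf.
have mXp A : measurable A -> measurable (X @^-1` A).
  by move=> mA; rewrite -[X in measurable X]setTI; exact: mX.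
transitivity (limn (fun n => \int[nu]_y (h n y)%:E))%E.
  rewrite -monotone_convergence//.
  - apply: eq_integral => y _; apply/esym/cvg_lim => //.
    by apply: cvg_nnsfun_approx.
  - by move=> n; exact/measurable_EFinP/measurable_funP.
  - by move=> n y _; rewrite lee_fin.
  - by move=> y _ m n mn; rewrite lee_fin; exact/lefP/nd_nnsfun_approx.
transitivity (limn (fun n => \int[mu]_x ((h n (X x))%:E * (g x)%:E)))%E; last first.
  rewrite -monotone_convergence//.
  - apply: eq_integral => x _; apply/cvg_lim => //.
    by apply: cvgeZr => //; exact: cvg_nnsfun_approx.
  - move=> n; apply: emeasurable_funM; last exact/measurable_EFinP.
    by apply/measurable_EFinP/measurableT_comp.
  - by move=> n x _; rewrite mule_ge0 ?lee_fin.
  - move=> x _ m n mn; rewrite lee_wpmul2r ?lee_fin//.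
    exact/lefP/nd_nnsfun_approx.
congr (limn _); apply/funext => n.
under eq_integral do rewrite fimfunE -fsumEFin//.
rewrite ge0_integral_fsum//; last 2 first.
- by move=> y; exact/measurable_EFinP/measurable_funM.
- by move=> y x _; rewrite nnfun_muleindic_ge0.
under [in RHS]eq_integral.
  move=> x _; rewrite fimfunE -fsumEFin// ge0_mule_fsuml; last first.
    by move=> y; exact: nnfun_muleindic_ge0.
  over.
rewrite ge0_integral_fsum//; last 2 first.
- move=> y; apply: emeasurable_funM; last exact/measurable_EFinP.
  by apply/measurable_EFinP/measurable_funM => //; exact: measurableT_comp.
- by move=> y x _; rewrite mule_ge0 ?lee_fin//; exact: nnfun_muleindic_ge0.
apply: eq_fsbigr => y /[!inE] -[y' _ yE].
have y0 : (0 <= y)%R by rewrite -yE.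
rewrite integralZl_indic_nnsfun// integral_indic// setIT nuE//.
rewrite integral_mkcond -ge0_integralZl_EFin//; last 2 first.
- by move=> x _; rewrite patchE; case: ifP => // _; rewrite lee_fin.
- apply/(measurable_restrictT _ _).1 => //; first exact: mXp.
  by apply/measurable_funTS/measurable_EFinP.
apply: eq_integral => x _; rewrite patchE indicE /=.
have -> : (x \in X @^-1` (h n @^-1` [set y])) = (X x \in h n @^-1` [set y]).
  by apply/idP/idP => /[!inE].
by case: ifP => _; rewrite ?mulr1 ?mulr0 ?mule0 ?mul0e.
Qed.

End integral_density.

Lemma measurable_preimage (d d' : measure_display) (T : measurableType d)
    (T' : measurableType d') (X : T -> T') (B : set T') :
  measurable_fun setT X -> measurable B -> measurable (X @^-1` B).
Proof. by move=> mX mB; rewrite -[X in measurable X]setTI; exact: mX. Qed.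

Lemma ge0_integral_gaussian_law (d : measure_display) (T : measurableType d)
    (R : realType) (P : probability T R) (X : T -> R) (m s : R) (f : R -> R) :
  measurable_fun setT X ->
  (forall B, measurable B -> P (X @^-1` B) = gaussian_law m s B) ->
  measurable_fun setT f -> (forall y, 0 <= f y) ->
  (\int[P]_x (f (X x))%:E =
   if s == 0%R then (f m)%:E
   else \int[lebesgue_measure]_y (f y * normal_pdf m s y)%:E)%E.
Proof.
move=> mX lawX mf f0.
(* [normal_prob] is a measure on [measurableTypeR R], whose structure is
   different from, but has the same measurable sets as, the default one on [R]. *)
pose X' : T -> measurableTypeR R := X.
have mX' : measurable_fun setT X' := mX.
have mf' : measurable_fun [set: measurableTypeR R] (fun y => (f y)%:E).
  exact/measurable_EFinP.
have := @ge0_integral_pushforward _ _ _ _ R _ mX' P setT _ measurableT mf'.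
rewrite preimage_setT => <- //; last by move=> y _; rewrite lee_fin.
case: ifPn => s0.
  transitivity (\int[dirac (m : measurableTypeR R)]_y (f y)%:E)%E.
    apply: eq_measure_integral => B mB _.
    by rewrite [LHS](lawX _ mB) /gaussian_law s0.
  by rewrite integral_dirac//= diracT mul1e.
transitivity (\int[normal_prob m s]_y (f y)%:E)%E.
  apply: eq_measure_integral => B mB _.
  by rewrite [LHS](lawX _ mB) /gaussian_law (negbTE s0).
apply: (@ge0_integral_density _ _ _ _ R lebesgue_measure (normal_prob m s) id
  (normal_pdf m s)) => //.
- exact: measurable_normal_pdf.
- by move=> x; exact: normal_pdf_ge0.
Qed.

(** Completing the square: the exponential factor shifts the mean of the normal density by
    [a * s ^+ 2] and leaves a constant. *)
Lemma gaussian_law_expR (d : measure_display) (T : measurableType d)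
    (R : realType) (P : probability T R) (X : T -> R) (m s a : R) :
  measurable_fun setT X ->
  (forall B, measurable B -> P (X @^-1` B) = gaussian_law m s B) ->
  (\int[P]_x (expR (a * (X x - m)))%:E = (expR (a ^+ 2 * s ^+ 2 / 2))%:E)%E.
Proof.
move=> mX lawX.
rewrite (@ge0_integral_gaussian_law _ _ _ _ _ m s (fun y => expR (a * (y - m))))//.
- case: eqVneq => [->|s0]; first by rewrite subrr mulr0 expr0n mulr0 mul0r.
  transitivity (\int[lebesgue_measure]_y
     ((expR (a ^+ 2 * s ^+ 2 / 2))%:E * (normal_pdf (m + a * s ^+ 2) s y)%:E))%E.
    apply: eq_integral => y _; rewrite -EFinM !normal_pdfE//; congr EFin.
    rewrite mulrCA [RHS]mulrCA; congr (_ * _).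
    by rewrite /normal_fun -!expRD; congr expR; field.
  rewrite ge0_integralZl//= ?lee_fin ?expR_ge0//.
  + by rewrite integral_normal_pdf mule1.
  + by apply/measurable_EFinP; exact: measurable_normal_pdf.
  + by move=> y _; rewrite lee_fin normal_pdf_ge0.
- apply: measurableT_comp => //; apply: measurable_funM => //.
  exact: measurable_funB.
Qed.

(** With [r = 1 - 2 * t * s ^+ 2], the exponential factor turns the density of variance [s ^+ 2]
    into that of variance [s ^+ 2 / r]; the value is the ratio of the two normalizing constants. *)
Lemma gaussian_law_expR_sqr (d : measure_display) (T : measurableType d)
    (R : realType) (P : probability T R) (X : T -> R) (m s t : R) :
  measurable_fun setT X ->
  (forall B, measurable B -> P (X @^-1` B) = gaussian_law m s B) ->
  0 < 1 - 2 * t * s ^+ 2 ->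
  (\int[P]_x (expR (t * (X x - m) ^+ 2))%:E =
   (Num.sqrt (1 - 2 * t * s ^+ 2))^-1%:E)%E.
Proof.
move=> mX lawX; move rE : (1 - _) => r r0.
rewrite (@ge0_integral_gaussian_law _ _ _ _ _ m s
  (fun y => expR (t * (y - m) ^+ 2)))//.
- have [s0|s0] := eqVneq s 0.
    by rewrite -rE s0 subrr expr0n !mulr0 expR0 subr0 sqrtr1 invr1.
  have q0 : Num.sqrt r != 0 by rewrite gt_eqF// sqrtr_gt0.
  pose s' := s / Num.sqrt r.
  have s'0 : s' != 0 by rewrite mulf_neq0// invr_eq0.
  have s'2 : s' ^+ 2 = s ^+ 2 / r by rewrite exprMn exprVn sqr_sqrtr// ltW.
  have expo (z q : R) : q != 0 -> 1 - 2 * t * s ^+ 2 = q ->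
      t * z + - z / (s ^+ 2 *+ 2) = - z / (s ^+ 2 / q *+ 2).
    move=> qn0 qE; have -> : t = (1 - q) / (2 * s ^+ 2) by rewrite -qE; field.
    by field; rewrite s0 qn0.
  transitivity (\int[lebesgue_measure]_y
     ((Num.sqrt r)^-1%:E * (normal_pdf m s' y)%:E))%E.
    apply: eq_integral => y _; rewrite -EFinM !normal_pdfE//; congr EFin.
    rewrite mulrCA [RHS]mulrA; congr (_ * _).
      rewrite /normal_peak s'2 -invfM -sqrtrM ?ltW//; congr (Num.sqrt _)^-1.
      by rewrite -!mulrnAr mulrA mulrCA divff ?mulr1// gt_eqF.
    rewrite /normal_fun -!expRD s'2; congr expR.
    by apply: expo; rewrite ?gt_eqF.
  rewrite ge0_integralZl//= ?lee_fin ?invr_ge0 ?sqrtr_ge0//.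
  + by rewrite integral_normal_pdf mule1.
  + by apply/measurable_EFinP; exact: measurable_normal_pdf.
  + by move=> y _; rewrite lee_fin normal_pdf_ge0.
- apply: measurableT_comp => //; apply: measurable_funM => //.
  by apply: measurable_funX; exact: measurable_funB.
Qed.

(** * Identification of the mean and variance of a Gaussian law *)

(** Near [a = 0] the right side is 1 up to second order, so the slope [c] of the left side must
    vanish. Instead of a limit, the single small value [a = c / D] gives a contradiction. *)
Lemma eq0_of_exp_ge (R : realType) (c v : R) : 0 <= v ->
  (forall a, 1 + a * c <= expR (a ^+ 2 * v / 2)) -> c = 0.
Proof.
move=> v0 H; apply/eqP; apply/negPn/negP => c0.
have c20 : 0 < c ^+ 2 by rewrite exprn_even_gt0.
(* With [k = D^-1], this choice gives [v * k + c ^+ 2 * v * k = 1 - k < 1], while the inequality at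
   [a = c / D] would force half of the left side to be at least 1. *)
pose D := 1 + v + c ^+ 2 * v.
have cv0 : 0 <= c ^+ 2 * v by rewrite mulr_ge0// ltW.
have D1 : 1 <= D by rewrite /D; lra.
have D0 : 0 < D by lra.
have := H (c / D); set z := _ * v / 2 => Hz.
have zE : z = c ^+ 2 * v / 2 * D^-1 ^+ 2 by rewrite /z exprMn; ring.
have i0 : 0 < D^-1 by rewrite invr_gt0.
have i1 : D^-1 <= 1 by rewrite invf_le1.
have iD : D^-1 * (1 + v + c ^+ 2 * v) = 1 by rewrite mulVf// gt_eqF.
have z1 : 0 <= 1 - z by rewrite zE; nra.
have : (1 + c / D * c) * (1 - z) <= 1.
  apply: le_trans (ler_wpM2r z1 Hz) _.
  have := expR_ge1Dx (- z); rewrite expRN => hz.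
  apply: le_trans (ler_wpM2l (expR_ge0 z) hz) _.
  by rewrite divff// gt_eqF// expR_gt0.
have -> : c / D * c = c ^+ 2 * D^-1 by ring.
rewrite zE; move: (D^-1) (c ^+ 2) i0 i1 iD c20 cv0 => k q k0 k1 kE q0 qv0 h.
have {}h : q * k * (1 - q * v / 2 * k ^+ 2) <= q * k * (v / 2 * k) by nra.
move: h; rewrite ler_pM2l ?mulr_gt0// => h.
have : q * v * k ^+ 2 <= q * v * k by rewrite ler_wpM2l// expr2 ler_piMl// ltW.
lra.
Qed.

(** Both sides are 1 at [t = 0], with slopes [q] and [v]; as [t] takes both signs, the slopes agree.
    Again one small value, [t = (q - v) / D], suffices. *)
Lemma eq_of_sqrt_ge (R : realType) (q v : R) : 0 <= q -> 0 <= v ->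
  (forall t, 0 < 1 - 2 * t * v -> 1 + t * q <= (Num.sqrt (1 - 2 * t * v))^-1) ->
  q = v.
Proof.
move=> q0 v0 H; apply/eqP; rewrite -subr_eq0; apply/negPn/negP.
move cE : (q - v) => c c0.
have cc0 : 0 < c ^+ 2 by rewrite exprn_even_gt0.
have a0 : 0 <= `|c| by [].
have ca : c <= `|c| by exact: ler_norm.
have ca' : - c <= `|c| by rewrite -normrN ler_norm.
(* At [t = c / D], the summand with [v] alone keeps the radicand positive, the one with [q] alone
   keeps [1 + t * q] nonnegative so that squaring is allowed, and the other two control the higher
   order terms. *)
pose D := 1 + 4 * q * v + 2 * `|c| * q ^+ 2 * v + 2 * `|c| * v + `|c| * q.
have [qv aqv] : 0 <= q * v /\ 0 <= `|c| * q ^+ 2 * v.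
  by rewrite !mulr_ge0// sqr_ge0.
have [av aq] : 0 <= `|c| * v /\ 0 <= `|c| * q by rewrite !mulr_ge0.
have D1 : 1 <= D by rewrite /D; lra.
have D0 : 0 < D by lra.
have i0 : 0 < D^-1 by rewrite invr_gt0.
have i1 : D^-1 <= 1 by rewrite invf_le1.
have iD : D^-1 * D = 1 by rewrite mulVf// gt_eqF.
move: (D^-1) i0 i1 iD; rewrite /D => k k0 k1 kE.
have cv : c * v <= `|c| * v by rewrite ler_wpM2r.
have cq : - c * q <= `|c| * q by rewrite ler_wpM2r.
have kp x y : x <= y -> k * x <= k * y by rewrite ler_pM2l.
have kn x : 0 <= x -> 0 <= k * x by move=> ?; rewrite mulr_ge0// ltW.
move: (kp _ _ cv) (kp _ _ cq) (kn _ qv) (kn _ aqv) (kn _ av) (kn _ aq).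
move=> b1 b2 b3 b4 b5 b6.
have r0 : 0 < 1 - 2 * (c * k) * v by lra.
have l0 : 0 <= 1 + c * k * q by lra.
have := H _ r0; rewrite -ler_sqr ?nnegrE ?invr_ge0 ?sqrtr_ge0//.
rewrite exprVn sqr_sqrtr ?(ltW r0)// -[leRHS]mul1r ler_pdivlMr// => h.
(* The first order part of the expansion is [2 * c * k * (q - v) = 2 * c ^+ 2 * k]. Once
   [c ^+ 2 * k] is factored out, the bracket is 2 plus terms too small to make it nonpositive. *)
have : c ^+ 2 * k * (2 + k * (q ^+ 2 - 4 * q * v) - 2 * c * k ^+ 2 * q ^+ 2 * v) <= 0.
  have -> : c ^+ 2 * k * (2 + k * (q ^+ 2 - 4 * q * v) - 2 * c * k ^+ 2 * q ^+ 2 * v)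
     = (1 + c * k * q) ^+ 2 * (1 - 2 * (c * k) * v) - 1.
    by rewrite -cE; ring.
  lra.
rewrite pmulr_rle0; last exact: mulr_gt0.
move=> h2.
have : c * q ^+ 2 * v * k ^+ 2 <= `|c| * q ^+ 2 * v * k.
  apply: le_trans (_ : `|c| * q ^+ 2 * v * k ^+ 2 <= _).
    by rewrite !ler_wpM2r ?sqr_ge0.
  by rewrite ler_wpM2l// expr2 ler_piMl// ltW.
have : 0 <= k * q ^+ 2 by rewrite mulr_ge0 ?sqr_ge0// ltW.
lra.
Qed.

(** A difference of the integrals of the positive and negative parts is finite only if both are.
    Thus finite moments, as given by the mean and covariance, carry integrability with them. *)
Lemma fin_num_integrable (d : measure_display) (T : measurableType d)
    (R : realType) (mu : {measure set T -> \bar R}) (f : T -> \bar R) :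
  measurable_fun setT f -> (\int[mu]_x f x)%E \is a fin_num ->
  mu.-integrable setT f.
Proof.
move=> mf; rewrite integralE fin_numB => /andP[fp fn].
apply/integrableP; split => //.
rewrite -[X in (integral _ _ X < _)%E]/(abse \o f) fune_abse.
rewrite ge0_integralD//.
- by rewrite lte_add_pinfty// ltey_eq ?fp ?fn.
- exact: measurable_funepos.
- exact: measurable_funeneg.
Qed.

(* The parameters of the law are read off its moments without computing a
   Gaussian moment: integrating [1 + z <= expR z] at [z = a (X - m)] and at
   [z = t X ^+ 2], with [a] and [t] of either sign, pins down [m] and [s ^+ 2]. *)
Lemma gaussian_law_moments (d : measure_display) (T : measurableType d)
    (R : realType) (P : probability T R) (X : T -> R) (m s v : R) :
  measurable_fun setT X ->
  (forall B, measurable B -> P (X @^-1` B) = gaussian_law m s B) ->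
  (\int[P]_x (X x)%:E = 0)%E -> (\int[P]_x (X x ^+ 2)%:E = v%:E)%E ->
  m = 0 /\ s ^+ 2 = v.
Proof.
move=> mX lawX EX EX2.
have mEX : measurable_fun setT (fun x => (X x)%:E) by exact/measurable_EFinP.
have mX2 : measurable_fun setT (fun x => X x ^+ 2) by exact: measurable_funX.
have iX : P.-integrable setT (fun x => (X x)%:E).
  by apply: fin_num_integrable; rewrite ?EX.
have iX2 : P.-integrable setT (fun x => (X x ^+ 2)%:E).
  by apply: fin_num_integrable; rewrite ?EX2//; exact/measurable_EFinP.
have icst r : P.-integrable setT (fun=> r%:E).
  exact: finite_measure_integrable_cst.
have Ecst r : (\int[P]_x r%:E = r%:E)%E.
  by have := expectation_cst P r; rewrite unlock.
have affine r a (Y : T -> R) y : P.-integrable setT (fun x => (Y x)%:E) ->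
    (\int[P]_x (Y x)%:E = y%:E)%E ->
    P.-integrable setT (fun x => (r + a * Y x)%:E) /\
    (\int[P]_x (r + a * Y x)%:E = (r + a * y)%:E)%E.
  move=> iY EY; have iaY := integrableZl measurableT a iY; split.
    exact: (integrableD measurableT (icst r) iaY).
  under eq_integral do rewrite EFinD EFinM.
  rewrite integralD//.
  by rewrite Ecst integralZl// EY.
(* This integrates [1 + z <= expR z] at [z = r + a * Y]; the exponential is integrable because its
   integral has the finite value [e]. *)
have tangent r a (Y : T -> R) y e : P.-integrable setT (fun x => (Y x)%:E) ->
    (\int[P]_x (Y x)%:E = y%:E)%E -> 
    (\int[P]_x (expR (r + a * Y x))%:E = e%:E)%E -> 1 + (r + a * y) <= e.
  move=> iY EY Ee; have [iA EA] := affine (1 + r) a _ _ iY EY.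
  rewrite addrA -lee_fin -EA -Ee; apply: le_integral => //.
    apply: fin_num_integrable; last by rewrite Ee.
    apply/measurable_EFinP/measurableT_comp => //; apply: measurable_funD => //.
    by apply: measurable_funM => //; apply/measurable_EFinP; exact: measurable_int iY.
  by move=> x _; rewrite lee_fin -addrA expR_ge1Dx.
have m0 : m = 0.
  apply/eqP; rewrite -oppr_eq0; apply/eqP; apply: (@eq0_of_exp_ge _ _ (s ^+ 2)).
    exact: sqr_ge0.
  move=> a; have := tangent (- (a * m)) a X 0 _ iX EX; rewrite mulr0 addr0 mulrN.
  apply; rewrite -(gaussian_law_expR _ _ _ _ _ _ _ a mX lawX).
  by apply: eq_integral => x _; congr (expR _)%:E; ring.
split=> //; subst m; apply/esym/eq_of_sqrt_ge.
- rewrite -lee_fin -EX2; apply: integral_ge0 => x _; rewrite lee_fin.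
  exact: sqr_ge0.
- exact: sqr_ge0.
- move=> t t0; have := tangent 0 t (fun x => X x ^+ 2) v _ iX2 EX2; rewrite add0r.
  apply; rewrite -(gaussian_law_expR_sqr _ _ _ _ _ _ _ _ mX lawX t0).
  by apply: eq_integral => x _; rewrite add0r subr0.
Qed.

(** * Expectation of a product of independent variables *)

Lemma integral_indic_preimage (d : measure_display) (T : measurableType d)
    (R : realType) (mu : {measure set T -> \bar R}) (X : T -> R) (B : set R) :
  measurable_fun setT X -> measurable B ->
  (\int[mu]_x (\1_B (X x))%:E = mu (X @^-1` B))%E.
Proof.
move=> mX mB; rewrite -[X in mu X]setIT -integral_indic//.
exact: measurable_preimage.
Qed.

Lemma prod_indic_preimage (T : Type) (I : finType) (R : realType) (X : I -> T -> R)
    (B : I -> set R) (x : T) :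
  \prod_i (\1_(B i) (X i x) : R) =
  \1_(\bigcap_(i in [set: I]) X i @^-1` B i) x.
Proof.
have [xB|xB] := pselect (forall i, B i (X i x)).
  rewrite big1 => [|i _]; first by rewrite indicE mem_set// => i _; exact: xB.
  by rewrite indicE mem_set.
rewrite [RHS]indicE memNset => [|xB']; last by apply: xB => i; exact: xB'.
have /existsNP[i iB] := xB.
by rewrite (bigD1 i)//= indicE memNset// mul0r.
Qed.

(* Induction on the number of indices at which [h] is not an indicator
   function. In the induction step all factors but one are frozen, and the two
   sides are measures of the set of which the remaining factor is the indicator. *)
Lemma expectation_prod_indep (d : measure_display) (T : measurableType d)
    (R : realType) (P : probability T R) (K : nat) (X : 'I_K -> T -> R)
    (h : 'I_K -> R -> R) (e : 'I_K -> R) :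
  (forall i, measurable_fun setT (X i)) ->
  (forall B : 'I_K -> set R, (forall i, measurable (B i)) ->
    P (\bigcap_(i in [set: 'I_K]) X i @^-1` B i) =
    (\prod_(i < K) P (X i @^-1` B i))%E) ->
  (forall i, measurable_fun setT (h i)) -> (forall i y, 0 <= h i y) ->
  (forall i, (\int[P]_x (h i (X i x))%:E = (e i)%:E)%E) ->
  (\int[P]_x (\prod_i h i (X i x))%:E = (\prod_i e i)%:E)%E.
Proof.
move=> mX ind.
suff H n : forall (h : 'I_K -> R -> R) (e : 'I_K -> R),
  (forall i : 'I_K, (n <= i)%N -> exists2 B : set R, measurable B & h i = \1_B) ->
  (forall i, measurable_fun setT (h i)) -> (forall i y, 0 <= h i y) ->
  (forall i, (\int[P]_x (h i (X i x))%:E = (e i)%:E)%E) ->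
  (\int[P]_x (\prod_i h i (X i x))%:E = (\prod_i e i)%:E)%E.
  (* At [n = K] no factor is required to be an indicator. *)
  by apply: (H K) => i; rewrite leqNgt ltn_ord.
elim: n => [|n IH] {}h {}e hB mh h0 he.
  have /choice[B BP] : forall i, exists B : set R, measurable B /\ h i = \1_B.
    by move=> i; have [B mB hE] := hB i (leq0n i); exists B.
  have mB i : measurable (X i @^-1` B i).
    by apply: measurable_preimage => //; have [] := BP i.
  under eq_integral do (under eq_bigr do rewrite (BP _).2); rewrite /=.
  under eq_integral do rewrite prod_indic_preimage.
  rewrite integral_indic//; last first.
    by apply: fin_bigcap_measurable => //; exact: finite_finset.
  rewrite setIT; apply: etrans (ind B _) _; first by move=> i; have [] := BP i.
  rewrite -prodEFin; apply: eq_bigr => i _.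
  by rewrite -he (BP i).2 integral_indic_preimage//; have [] := BP i.
have [nK|Kn] := ltnP n K; last first.
  by apply: IH => // i ni; have := ltn_ord i; rewrite ltnNge (leq_trans Kn ni).
pose j := Ordinal nK.
pose G x := \prod_(i | i != j) h i (X i x).
have G0 x : 0 <= G x by apply: prodr_ge0.
have mG : measurable_fun setT G.
  rewrite /G; under eq_fun do rewrite -big_filter.
  apply: measurable_prod => i _.
  exact: measurableT_comp.
have e0 i : 0 <= e i.
  by rewrite -lee_fin -he; apply: integral_ge0 => x _; rewrite lee_fin.
pose c := \prod_(i | i != j) e i.
have c0 : 0 <= c by apply: prodr_ge0.
pose Xj : {mfun T >-> R} := mfun_Sub (mem_set (mX j)).
(* The induction hypothesis, with the indicator of [B] as factor [j], shows that the image under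
   [X j] of the measure with density [G] is [c] times the law of [X j]. Integrating [h j] against
   both gives the induction step. *)
have nuE (B : set R) : measurable B ->
    (mscale (NngNum c0) (distribution P Xj) B =
     \int[P]_(x in X j @^-1` B) (G x)%:E)%E.
  move=> mB; pose h' i := if i == j then \1_B else h i.
  pose e' i := if i == j then fine (P (X j @^-1` B)) else e i.
  have mXB : measurable (X j @^-1` B) by apply: measurable_preimage.
  have : (\int[P]_x (\prod_i h' i (X i x))%:E = (\prod_i e' i)%:E)%E.
    apply: IH => i; rewrite /h' /e'; case: eqVneq => [ij|ij] //.
    - by exists B.
    - by move=> ni; apply: hB; rewrite ltn_neqAle ni andbT eq_sym.
    - rewrite ij fineK ?fin_num_measure//; exact: integral_indic_preimage.
  rewrite (bigD1 j)//= {1}/e' eqxx.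
  rewrite (eq_bigr e) => [|i /negbTE ij]; last by rewrite /e' ij.
  rewrite EFinM fineK ?fin_num_measure// => EG.
  rewrite [LHS]muleC -[LHS]EG.
  rewrite [RHS]integral_mkcond; apply: eq_integral => x _.
  rewrite patchE (bigD1 j)//= {1}/h' eqxx indicE.
  rewrite (eq_bigr (fun i => h i (X i x))) => [|i /negbTE ij]; last first.
    by rewrite /h' ij.
  have -> : (X j x \in B) = (x \in X j @^-1` B) by apply/idP/idP => /[!inE].
  by case: ifP => _; rewrite ?mul1r ?mul0r.
under eq_integral do rewrite (bigD1 j)//= EFinM.
rewrite -(@ge0_integral_density _ _ _ _ _ P _ (X j) G (mX j) mG G0 nuE
  (fun y => (h j y)%:E)).
- rewrite ge0_integral_mscale//=.
  + rewrite ge0_integral_distribution//.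
      rewrite [X in (_ * X)%E](_ : _ = (e j)%:E); last exact: he.
      by rewrite -EFinM mulrC [in RHS](bigD1 j).
      exact/measurable_EFinP.
    by move=> y; rewrite lee_fin.
  + exact/measurable_EFinP.
  + by move=> y _; rewrite lee_fin.
- exact/measurable_EFinP.
- by move=> y; rewrite lee_fin.
Qed.

(** * Tail bounds for a sum of squares of independent Gaussians *)

(** Keeping [t] on both sides of the event covers both tails: [t > 0] gives the upper one and
    [t < 0] the lower one. Independence makes the exponential moment a product of [K] equal
    factors. *)
Lemma gaussian_sum_sqr_chernoff (d : measure_display) (T : measurableType d)
    (R : realType) (P : probability T R) (K : nat) (X : 'I_K -> T -> R)
    (v t a : R) :
  (forall i, measurable_fun setT (X i)) ->
  (forall B : 'I_K -> set R, (forall i, measurable (B i)) ->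
    P (\bigcap_(i in [set: 'I_K]) X i @^-1` B i) =
    (\prod_(i < K) P (X i @^-1` B i))%E) ->
  (forall i, exists2 s, s ^+ 2 = v & forall B, measurable B ->
    P (X i @^-1` B) = gaussian_law 0 s B) ->
  0 < 1 - 2 * t * v ->
  (P [set x | (t * a <= t * \sum_i X i x ^+ 2)%R] <=
   (expR (- (t * a)) * (Num.sqrt (1 - 2 * t * v))^-1 ^+ K)%:E)%E.
Proof.
move=> mX ind lawX t0.
have mQ : measurable_fun setT (fun x => t * \sum_i X i x ^+ 2).
  apply: measurable_funM => //; apply: measurable_sum => i.
  exact: measurable_funX.
pose Q : {RV P >-> R} := mfun_Sub (mem_set mQ).
(* The factor [t], of either sign, is part of [Q], so the bound is used with the positive exponent
   1. *)
have := chernoff Q (t * a) ltr01; rewrite /mmt_gen_fun mul1r; congr (_ <= _)%E.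
rewrite EFinM muleC; congr (_ * _)%E; rewrite unlock.
rewrite -[K in (_ ^+ K)]card_ord -prodr_const.
rewrite -(@expectation_prod_indep _ _ _ P _ X (fun _ y => expR (t * y ^+ 2)))//.
- apply: eq_integral => x _ /=.
  by rewrite mulr1 mulr_sumr expR_sum.
- move=> i; apply: measurableT_comp => //; apply: measurable_funM => //.
- move=> i; have [s sv lawi] := lawX i; rewrite -sv in t0 *.
  rewrite -(gaussian_law_expR_sqr _ _ _ _ _ _ _ _ (mX i) lawi t0).
  by apply: eq_integral => x _; rewrite subr0.
Qed.

Lemma measurable_ler (d : measure_display) (T : measurableType d)
    (R : realType) (f g : T -> R) :
  measurable_fun setT f -> measurable_fun setT g ->
  measurable [set x | f x <= g x].
Proof.
move=> mf mg; rewrite -[X in measurable X]setTI.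
exact: measurable_fun_le.
Qed.

Lemma measurable_sqrt (d : measure_display) (T : measurableType d)
    (R : realType) (f : T -> R) :
  measurable_fun setT f -> measurable_fun setT (fun x => Num.sqrt (f x)).
Proof.
apply: measurableT_comp; apply: continuous_measurable_fun.
exact: sqrt_continuous.
Qed.

Lemma gaussian_sum_sqr_two_sided (d : measure_display) (T : measurableType d)
    (R : realType) (P : probability T R) (K : nat) (X : 'I_K -> T -> R)
    (v w : R) :
  (forall i, measurable_fun setT (X i)) ->
  (forall B : 'I_K -> set R, (forall i, measurable (B i)) ->
    P (\bigcap_(i in [set: 'I_K]) X i @^-1` B i) =
    (\prod_(i < K) P (X i @^-1` B i))%E) ->
  (forall i, exists2 s, s ^+ 2 = v & forall B, measurable B ->
    P (X i @^-1` B) = gaussian_law 0 s B) ->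
  (3 <= K)%N -> 0 <= v -> expR 2^-1 < w ->
  (P [set x | ~ (w^-1 * Num.sqrt (K%:R^-1 * \sum_i X i x ^+ 2) <= Num.sqrt v
                 <= w * Num.sqrt (K%:R^-1 * \sum_i X i x ^+ 2))%R] <=
   ((expR 2^-1 / w) ^+ K)%:E)%E.
Proof.
move=> mX ind lawX K3 v0 ew.
have w0 : 0 < w by apply: lt_trans ew; exact: expR_gt0.
have K0 : 0 < K%:R :> R by rewrite ltr0n (leq_trans _ K3).
have c0 : 0 <= expR 2^-1 / w by rewrite divr_ge0 ?expR_ge0// ltW.
have mQ : measurable_fun setT (fun x => \sum_i X i x ^+ 2).
  by apply: measurable_sum => i; exact: measurable_funX.
pose S x := Num.sqrt (K%:R^-1 * \sum_i X i x ^+ 2).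
have mS : measurable_fun setT S.
  by apply: measurable_sqrt; exact: measurable_funM.
pose good := [set x | w^-1 * S x <= Num.sqrt v] `&` [set x | Num.sqrt v <= w * S x].
have mgood : measurable good.
  by apply: measurableI; apply: measurable_ler => //; exact: measurable_funM.
rewrite [X in P X](_ : _ = ~` good); last first.
  by apply/seteqP; split=> x /= h hx; apply: h; [apply/andP|case/andP: hx].
(* If [v = 0], all [X i] vanish almost surely and both inequalities read [0 <= 0]; the exponents
   below divide by [v]. *)
move: v0; rewrite le_eqVlt => /predU1P[v0|v0].
  pose Z := \bigcap_(i in [set: 'I_K]) X i @^-1` [set 0].
  have mZ : measurable Z.
    apply: fin_bigcap_measurable => [|i _]; first exact: finite_finset.
    exact: measurable_preimage.
  have PZ : P Z = 1%E.
    rewrite ind// big1// => i _; have [s] := lawX i.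
    rewrite -v0 => /eqP; rewrite sqrf_eq0 => /eqP -> ->//.
    by rewrite /gaussian_law eqxx diracE mem_set.
  apply: (@le_trans _ _ (P (~` Z))).
    apply: le_measure; rewrite ?inE; [exact: measurableC..|].
    apply: subsetC => x Zx; have S0 : S x = 0.
      rewrite /S big1 ?mulr0 ?sqrtr0// => i _.
      by rewrite (Zx i Logic.I) expr0n.
    by split; rewrite /= S0 -v0 sqrtr0 mulr0.
  by rewrite probability_setC// PZ subee// lee_fin exprn_ge0.
move yE : (w ^+ 2) => y.
have y0 : 0 < y by rewrite -yE exprn_gt0.
have ey : expR 1 < y.
  by rewrite -yE [ltLHS](_ : _ = expR 2^-1 ^+ 2) ?ltrXn2r// -expRM_natl mulfV.
have y1 : 1 < y by apply: lt_trans ey; rewrite expR_gt1.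
(* These exponents minimize the two Chernoff bounds; they make [1 - 2 * t * v] equal to [y^-1] and
   [y], with square roots [w^-1] and [w]. *)
pose t1 := (1 - y^-1) / (2 * v); pose t2 := - ((y - 1) / (2 * v)).
have t10 : 0 < t1 by rewrite divr_gt0 ?subr_gt0 ?invf_lt1 ?mulr_gt0.
have t20 : t2 < 0 by rewrite oppr_lt0 divr_gt0 ?subr_gt0 ?mulr_gt0.
have vn0 : v != 0 by rewrite gt_eqF.
have yn0 : y != 0 by rewrite gt_eqF.
have wn0 : w != 0 by rewrite gt_eqF.
have t1E : 1 - 2 * t1 * v = y^-1 by rewrite /t1; field; rewrite vn0 yn0.
have t2E : 1 - 2 * t2 * v = y by rewrite /t2; field.
have sy : Num.sqrt y = w by rewrite -yE sqrtr_sqr gtr0_norm.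
(* At these values of the sum of squares, [w^-1 * S] and [w * S] respectively equal [Num.sqrt v]. *)
pose a1 := K%:R * v * y; pose a2 := K%:R * v / y.
pose U1 := [set x | t1 * a1 <= t1 * \sum_i X i x ^+ 2].
pose U2 := [set x | t2 * a2 <= t2 * \sum_i X i x ^+ 2].
have mU1 : measurable U1 by apply: measurable_ler => //; exact: measurable_funM.
have mU2 : measurable U2 by apply: measurable_ler => //; exact: measurable_funM.
(* Writing the factor [w] as [y / w] brings out [expR 2^-1 / w], which the lower tail shares. *)
have PU1 : (P U1 <= ((expR 2^-1 / w * (y * expR (- (y / 2)))) ^+ K)%:E)%E.
  apply: le_trans (gaussian_sum_sqr_chernoff _ _ _ _ _ _ _ _ _ mX ind lawX _) _.
    by rewrite t1E invr_gt0.
  rewrite t1E sqrtrV ?(ltW y0)// sy invrK lee_fin.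
  rewrite (_ : - (t1 * a1) = K%:R * (2^-1 - y / 2)); last first.
    by rewrite /t1 /a1; field; rewrite vn0 yn0.
  rewrite expRM_natl expRD -exprMn le_eqVlt; apply/orP; left; apply/eqP.
  by congr (_ ^+ K); rewrite -yE; field.
have PU2 : (P U2 <= ((expR 2^-1 / w * expR (- (2 * y)^-1)) ^+ K)%:E)%E.
  apply: le_trans (gaussian_sum_sqr_chernoff _ _ _ _ _ _ _ _ _ mX ind lawX _) _.
    by rewrite t2E.
  rewrite t2E sy lee_fin.
  rewrite (_ : - (t2 * a2) = K%:R * (2^-1 - (2 * y)^-1)); last first.
    by rewrite /t2 /a2; field; rewrite vn0 yn0.
  rewrite expRM_natl expRD -exprMn le_eqVlt; apply/orP; left; apply/eqP.
  by congr (_ ^+ K); field.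
apply: (@le_trans _ _ (P (U1 `|` U2))).
  apply: le_measure; rewrite ?inE; [exact: measurableC|exact: measurableU|].
  rewrite -[X in _ `<=` X]setCK; apply: subsetC => x.
  rewrite setCU => -[/= /negP + /negP].
  rewrite -!ltNge ltr_pM2l// ltr_nM2l// => Q1 Q2.
  split => /=.
    rewrite ler_pdivrMl// -sy -sqrtrM ?(ltW y0)// ler_wsqrtr//.
    by rewrite ler_pdivrMl// (mulrC y) mulrA ltW.
  rewrite -ler_pdivrMl// -sy -sqrtrV ?(ltW y0)//.
  rewrite -sqrtrM ?invr_ge0 ?(ltW y0)// ler_wsqrtr//.
  by rewrite ler_pdivlMl// (mulrC y^-1) mulrA ltW.
apply: le_trans (measureU2 _ mU1 mU2) _.
apply: le_trans (leeD PU1 PU2) _.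
rewrite -EFinD lee_fin; move: (expR 2^-1 / w) c0 => c c0.
rewrite !(exprMn K c) -mulrDr ler_piMr ?exprn_ge0//.
by rewrite chi2_tails_le1// ltW.
Qed.

(** * From Gaussian vectors to scalar products *)

(** The sets with Borel preimage form a sigma-algebra, which contains the open intervals by
    continuity, and these generate. *)
Lemma borel_preimage (X : topologicalType) (R : realType) (phi : X -> R)
    (B : set R) :
  continuous phi -> measurable B -> borel (phi @^-1` B).
Proof.
move=> cphi; suff : measurable `<=` image_set_system setT phi (@borel X).
  by move=> /(_ B) /[apply]; rewrite /image_set_system/= setTI.
rewrite [X in X `<=` _](RGenOpens.measurableE R).
apply: smallest_sub; first exact/sigma_algebra_image/smallest_sigma_algebra.
move=> _ [a [b ->]]; apply: sub_sigma_algebra; rewrite setTI.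
by move/continuousP : cphi; apply; exact: interval_open.
Qed.

Lemma continuous_dotmul (R : realType) (N : nat) (a : 'cV[R]_N) :
  continuous (fun z : 'cV[R]_N => (a^T *m z) 0 0).
Proof.
rewrite (_ : (fun _ => _) = fun z : 'cV[R]_N => \sum_i a i 0 * z i 0); last first.
  by apply/funext => z; rewrite mxE; apply: eq_bigr => i _; rewrite mxE.
apply: continuous_big => [|i _ z]; first exact: add_continuous.
by apply: continuousM; [exact: cst_continuous|exact: coord_continuous].
Qed.

Lemma expectation_lincomb (d : measure_display) (T : measurableType d)
    (R : realType) (P : probability T R) (I : finType) (c r : I -> R)
    (F : I -> T -> R) :
  (forall i, measurable_fun setT (F i)) ->
  (forall i, (\int[P]_x (F i x)%:E = (r i)%:E)%E) ->
  (\int[P]_x (\sum_i c i * F i x)%:E = (\sum_i c i * r i)%:E)%E.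
Proof.
move=> mF EF.
have iF i : P.-integrable setT (fun x => (F i x)%:E).
  by apply: fin_num_integrable; [exact/measurable_EFinP|rewrite EF].
under eq_integral do rewrite -sumEFin.
rewrite integral_sum//.
  rewrite -sumEFin; apply: eq_bigr => i _.
  under eq_integral do rewrite EFinM.
  by rewrite integralZl// EF.
move=> i; under eq_fun do rewrite EFinM.
exact: integrableZl.
Qed.

Lemma measurable_dotmul (d : measure_display) (T : measurableType d)
    (R : realType) (N : nat) (Z : T -> 'cV[R]_N) (a : 'cV[R]_N) :
  random_vector Z -> measurable_fun setT (fun x => (a^T *m Z x) 0 0).
Proof.
move=> mZ _ B mB; rewrite setTI.
exact: mZ (borel_preimage _ _ _ _ (@continuous_dotmul _ _ a) mB).
Qed.

(** The definition of [gaussian_vector] leaves the parameters of the law unspecified. Bilinearity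
    computes the first two moments, and [gaussian_law_moments] then fixes the parameters, [s] up to
    sign. *)
Lemma gaussian_vector_dotmul (d : measure_display) (T : measurableType d)
    (R : realType) (P : probability T R) (N : nat) (Z : T -> 'cV[R]_N)
    (Sigma : 'M[R]_N) (a : 'cV[R]_N) :
  gaussian_vector P Z -> has_mean P Z 0 -> has_cov P Z Sigma ->
  exists2 s, s ^+ 2 = (a^T *m Sigma *m a) 0 0 & forall B, measurable B ->
    P ((fun x => (a^T *m Z x) 0 0) @^-1` B) = gaussian_law 0 s B.
Proof.
move=> [mZ gZ] EZ covZ.
have aZE x : (a^T *m Z x) 0 0 = \sum_i a i 0 * Z x i 0.
  by rewrite mxE; apply: eq_bigr => i _; rewrite mxE.
have mZi i : measurable_fun setT (fun x => Z x i 0).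
  have := measurable_dotmul _ _ _ _ _ (delta_mx i 0) mZ.
  congr measurable_fun; apply/funext => x.
  by rewrite trmx_delta -rowE mxE.
have EZi i : (\int[P]_x (Z x i 0)%:E = 0%:E)%E.
  by have := EZ i; rewrite unlock mxE.
have EZZ i j : (\int[P]_x (Z x i 0 * Z x j 0)%:E = (Sigma i j)%:E)%E.
  have := covZ i j; rewrite covariance.unlock !EZ !mxE/= expectation.unlock.
  move=> <-; apply: eq_integral => x _ /=.
  by rewrite !fctE/= !subr0.
have EaZ : (\int[P]_x ((a^T *m Z x) 0 0)%:E = 0)%E.
  under eq_integral do rewrite aZE.
  rewrite (@expectation_lincomb _ _ _ _ _ _ (fun=> 0))//.
  by rewrite big1// => i _; rewrite mulr0.
have EaZ2 : (\int[P]_x ((a^T *m Z x) 0 0 ^+ 2)%:E =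
    ((a^T *m Sigma *m a) 0 0)%:E)%E.
  (* The square is one linear combination indexed by pairs, to which [expectation_lincomb]
     applies. *)
  transitivity (\int[P]_x (\sum_(ij : 'I_N * 'I_N)
      (a ij.1 0 * a ij.2 0) * (Z x ij.1 0 * Z x ij.2 0))%:E)%E.
    apply: eq_integral => x _; rewrite aZE expr2 big_distrlr/=; congr EFin.
    by rewrite pair_bigA; apply: eq_bigr => -[i j] _; rewrite mulrACA.
  rewrite (@expectation_lincomb _ _ _ _ _ _ (fun ij => Sigma ij.1 ij.2))//.
    congr EFin; rewrite -(pair_bigA _ (fun i j => a i 0 * a j 0 * Sigma i j))/=.
    rewrite exchange_big/= mxE; apply: eq_bigr => j _.
    rewrite mxE big_distrl/=; apply: eq_bigr => i _.
    by rewrite mxE mulrAC.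
  by move=> ij; exact: measurable_funM.
have [m [s lawZ]] := gZ a.
have maZ := measurable_dotmul _ _ _ _ _ a mZ.
have [m0 s2] := gaussian_law_moments _ _ _ _ _ _ _ _ maZ lawZ EaZ EaZ2.
by subst m; exists s.
Qed.

Lemma dotmulC (R : comPzRingType) (N : nat) (a b : 'cV[R]_N) :
  (a^T *m b) 0 0 = (b^T *m a) 0 0.
Proof. by rewrite !mxE; apply: eq_bigr => i _; rewrite !mxE mulrC. Qed.

Lemma measurable_estimator (d : measure_display) (T : measurableType d)
    (R : realType) (N K : nat) (Z : 'I_K -> T -> 'cV[R]_N) (v : 'cV[R]_N) :
  (forall i, random_vector (Z i)) ->
  measurable_fun setT (fun x => estimator (fun i => Z i x) v).
Proof.
move=> mZ; apply: measurable_sqrt; apply: measurable_funM => //.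
apply: measurable_sum => i; apply: measurable_funX.
under eq_fun do rewrite dotmulC.
exact: measurable_dotmul.
Qed.

Lemma estimator_concentration (d : measure_display) (T : measurableType d)
    (R : realType) (P : probability T R) (N K : nat)
    (Z : 'I_K -> T -> 'cV[R]_N) (Sigma : 'M[R]_N) (v : 'cV[R]_N) (w : R) :
  psdmx Sigma -> (forall i, gaussian_vector P (Z i)) ->
  (forall i, has_mean P (Z i) 0) -> (forall i, has_cov P (Z i) Sigma) ->
  independent_vectors P Z -> (3 <= K)%N -> expR 2^-1 < w ->
  (P [set x | ~ (w^-1 * estimator (fun i => Z i x) v <= seminorm Sigma v
                 <= w * estimator (fun i => Z i x) v)%R] <=
   ((expR 2^-1 / w) ^+ K)%:E)%E.
Proof.
move=> [_ psd] gZ mZ covZ indZ K3 ew.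
rewrite /estimator; under eq_set => x.
  under eq_bigr do rewrite dotmulC.
  over.
apply: (gaussian_sum_sqr_two_sided _ _ _ _ _ (fun i x => (v^T *m Z i x) 0 0)) => //.
- by move=> i; apply: measurable_dotmul; have [] := gZ i.
- move=> B mB; apply: (indZ (fun i => (fun z => (v^T *m z) 0 0) @^-1` B i)) => i.
  by apply: borel_preimage => //; exact: continuous_dotmul.
- by move=> i; exact: gaussian_vector_dotmul.
Qed.

(** * Union bound, averages over the parameters and the conclusion *)

Lemma probability_bigcap_ge (d : measure_display) (T : measurableType d)
    (R : realType) (P : probability T R) (I : choiceType) (A : set I)
    (G : I -> set T) (eps : R) :
  finite_set A -> (forall i, A i -> measurable (G i)) ->
  (forall i, A i -> (P (~` G i) <= eps%:E)%E) ->
  ((1 - (ncard A)%:R * eps)%:E <= P (\bigcap_(i in A) G i))%E.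
Proof.
move=> finA mG PG.
have mI : measurable (\bigcap_(i in A) G i) by exact: fin_bigcap_measurable.
rewrite -[X in P X]setCK probability_setC; last exact: measurableC.
rewrite EFinB leeB// setC_bigcap.
apply: (@le_trans _ _ (\sum_(i \in A) P (~` G i))%E).
  apply: content_sub_fsum => //.
  - by move=> i Ai; apply: measurableC; exact: mG.
  - by rewrite -setC_bigcap; exact: measurableC.
rewrite fsbig_finite//=.
apply: (@le_trans _ _ (\sum_(i <- fset_set A) eps%:E)%E).
  rewrite big_seq [leRHS]big_seq; apply: lee_sum => i.
  by rewrite in_fset_set// inE => /PG.
by rewrite sumEFin big_const_seq count_predT iter_addr_0 /ncard cardfE mulr_natl.
Qed.

Lemma ler_rms (R : realType) (I : choiceType) (A : set I) (F G : I -> R) :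
  finite_set A -> (forall i, A i -> 0 <= F i <= G i) -> rms A F <= rms A G.
Proof.
move=> finA FG; rewrite /rms ler_wsqrtr// ler_wpM2l ?invr_ge0//.
rewrite !fsbig_finite//= big_seq [leRHS]big_seq; apply: ler_sum => i.
rewrite in_fset_set// inE => /FG /andP[F0 FGi].
by rewrite lerXn2r// nnegrE (le_trans F0).
Qed.

Lemma rmsZ (R : realType) (I : choiceType) (A : set I) (F : I -> R) (c : R) :
  finite_set A -> 0 <= c -> rms A (fun i => c * F i) = c * rms A F.
Proof.
move=> finA c0; rewrite /rms; under eq_fsbigr do rewrite exprMn.
rewrite !fsbig_finite//= -mulr_sumr mulrCA sqrtrM ?sqr_ge0// sqrtr_sqr.
by rewrite ger0_norm.
Qed.

(** The condition on [K] is the logarithm of [n / delta <= (w / expR 2^-1) ^+ K], divided by a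
    logarithm that is positive since [w > expR 2^-1]. *)
Lemma sample_size_bound (R : realType) (n K : nat) (delta w : R) :
  (0 < n)%N -> 0 < delta -> expR 2^-1 < w ->
  (ln n%:R + ln delta^-1) / ln (w / expR 2^-1) <= K%:R ->
  n%:R * (expR 2^-1 / w) ^+ K <= delta.
Proof.
move=> n0 d0 ew; have w0 : 0 < w by apply: lt_trans ew; exact: expR_gt0.
have q1 : 1 < w / expR 2^-1 by rewrite ltr_pdivlMr ?expR_gt0// mul1r.
have q0 : 0 < w / expR 2^-1 by apply: lt_trans q1.
rewrite ler_pdivrMr ?ln_gt0// -lnM ?posrE ?ltr0n ?invr_gt0// [leRHS]mulr_natl -lnXn//.
rewrite ler_ln ?posrE ?mulr_gt0 ?ltr0n ?invr_gt0 ?exprn_gt0// => h.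
rewrite -invf_div exprVn ler_pdivrMr ?exprn_gt0// mulrC -ler_pdivrMr//.
Qed.

Theorem corollary3p4
  (d : measure_display) (T : measurableType d) (R : realType)
  (Pr : probability T R)
  (p N M K : nat)
  (Pi : 'I_p -> set R)
  (finPi : forall i, finite_set (Pi i))
  (Pi_neq0 : prodset Pi !=set0)
  (A : 'rV[R]_p -> 'M[R]_N) (f u ut : 'rV[R]_p -> 'cV[R]_N)
  (A_unit : forall mu, prodset Pi mu -> A mu \in unitmx)
  (Au : forall mu, prodset Pi mu -> A mu *m u mu = f mu)
  (ut_sep : separated_form M Pi ut)
  (Sigma : 'M[R]_N) (Sigma_psd : psdmx Sigma)
  (Z : 'I_K -> T -> 'cV[R]_N)
  (Z_gauss : forall i, gaussian_vector Pr (Z i))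
  (Z_mean : forall i, has_mean Pr (Z i) 0)
  (Z_cov : forall i, has_cov Pr (Z i) Sigma)
  (Z_indep : independent_vectors Pr Z)
  (Y : 'I_K -> 'rV[R]_p -> T -> 'cV[R]_N)
  (AY : forall i mu x, prodset Pi mu -> (A mu)^T *m Y i mu x = Z i x)
  (delta w : R) (delta_gt0 : 0 < delta) (delta_lt1 : delta < 1)
  (w_gt : Num.sqrt (expR 1) < w)
  (K_ge : Num.max ((ln (ncard (prodset Pi))%:R + ln delta^-1)
                   / ln (w / Num.sqrt (expR 1))) 3 <= K%:R) :
  let Delta (x : T) (mu : 'rV[R]_p) : R :=
    estimator (fun i => Y i mu x) (residual (A mu) (f mu) (ut mu)) in
  let err (mu : 'rV[R]_p) : R := seminorm Sigma (u mu - ut mu) in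
  ((1 - delta)%:E <=
     Pr [set x | forall mu, prodset Pi mu ->
           (w^-1 * Delta x mu <= err mu <= w * Delta x mu)%R])%E
  /\
  ((1 - delta)%:E <=
     Pr [set x | (w^-1 * rms (prodset Pi) (Delta x)
                   <= rms (prodset Pi) err
                   <= w * rms (prodset Pi) (Delta x))%R])%E.
Proof.
move=> Delta err; set Q := prodset Pi in Pi_neq0 A_unit Au ut_sep AY K_ge Delta err *.
have finQ : finite_set Q by exact: finite_prodset.
have n0 : (0 < ncard Q)%N.
  rewrite /ncard cardfs_gt0; apply/eqP => Q0.
  have [mu Qmu] := Pi_neq0; have : mu \in fset_set Q by rewrite in_fset_set// inE.
  by rewrite Q0 inE.
move: K_ge w_gt; rewrite sqrt_expR1 ge_max => /andP[K_ge K3] w_gt.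
have {}K3 : (3 <= K)%N by rewrite -(ler_nat R).
have w0 : 0 < w by apply: lt_trans w_gt; exact: expR_gt0.
(* Measurability is given for [Z] and not for [Y], so the events are handled through the primal
   expression, available on [Q]. *)
have DeltaE x mu : Q mu -> Delta x mu = estimator (fun i => Z i x) (u mu - ut mu).
  move=> Qmu; apply/esym/estimator_dual; first exact: Au.
  by move=> i; exact: AY.
have rvZ i : random_vector (Z i) by have [] := Z_gauss i.
pose good mu := [set x | w^-1 * Delta x mu <= err mu <= w * Delta x mu].
have mD mu : Q mu -> measurable_fun setT (Delta ^~ mu).
  move=> Qmu; under eq_fun do rewrite DeltaE//.
  exact: measurable_estimator.
have msandwich (g : T -> R) e : measurable_fun setT g ->
    measurable [set x | w^-1 * g x <= e <= w * g x].
  move=> mf; rewrite (_ : [set _ | _] =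
    [set x | w^-1 * g x <= e] `&` [set x | e <= w * g x]); last first.
    by apply/seteqP; split=> x /=; [move/andP|move/andP].
  by apply: measurableI; apply: measurable_ler => //; exact: measurable_funM.
have mgood mu : Q mu -> measurable (good mu) by move=> /mD; exact: msandwich.
have Pgood mu : Q mu -> (Pr (~` good mu) <= ((expR 2^-1 / w) ^+ K)%:E)%E.
  move=> Qmu.
  rewrite (_ : ~` good mu = [set x |
      ~ (w^-1 * estimator (fun i => Z i x) (u mu - ut mu) <= err mu
         <= w * estimator (fun i => Z i x) (u mu - ut mu))]).
    exact: estimator_concentration.
  by apply/funext => x; rewrite /setC /good /mkset DeltaE.
have main : ((1 - delta)%:E <= Pr (\bigcap_(mu in Q) good mu))%E.
  apply: le_trans (probability_bigcap_ge _ _ _ _ _ _ _ _ finQ mgood Pgood).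
  by rewrite lee_fin lerD2l lerN2; exact: sample_size_bound.
split; first exact: main.
(* The event on averages contains the event on all parameters; monotonicity of [Pr] also asks that
   both be measurable. *)
apply: le_trans main _; apply: le_measure; rewrite ?inE.
- exact: fin_bigcap_measurable.
- apply: msandwich; apply: measurable_sqrt; apply: measurable_funM => //.
  rewrite (_ : (fun _ => _) =
    fun x => \sum_(mu <- fset_set Q)
      estimator (fun i => Z i x) (u mu - ut mu) ^+ 2).
    by apply: measurable_sum => mu; apply: measurable_funX; exact: measurable_estimator.
  apply/funext => x; rewrite fsbig_finite//= big_seq [RHS]big_seq.
  by apply: eq_bigr => mu; rewrite in_fset_set// inE => Qmu; rewrite DeltaE.
- move=> x goodx; apply/andP; split.
  + rewrite -rmsZ ?invr_ge0 ?(ltW w0)//; apply: ler_rms => // mu Qmu.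
    by rewrite mulr_ge0 ?invr_ge0 ?(ltW w0) ?sqrtr_ge0//=; case/andP: (goodx _ Qmu).
  + rewrite -rmsZ ?(ltW w0)//; apply: ler_rms => // mu Qmu.
    by rewrite sqrtr_ge0/=; case/andP: (goodx _ Qmu).
Qed.
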